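(* Let $B$ be a Banach SSD space (Simons space) and $A\subseteq B$ a maximally $q$-positive set. The map $\mathbb{E}_c(A)\to\mathcal{H}(A)$, $E\mapsto\Lambda_E$, is a bijection, with inverse given by $\mathcal{H}(A)\to\mathbb{E}_c(A)$, $h\mapsto A_h$. Moreover, $A_{\Lambda_E}=E$ for all $E\in\mathbb{E}_c(A)$ and $\Lambda_{A_h}=h$ for all $h\in\mathcal{H}(A)$.
   Context: A symmetrically self-dual space (SSD space) is a pair $(B,\lfloor\cdot,\cdot\rfloor)$ where $B$ is a nonzero real vector space and $\lfloor\cdot,\cdot\rfloor:B\times B\to\mathbb{R}$ is a symmetric bilinear form. Put $q:B\to\mathbb{R}$, $q(b)=\frac12\lfloor b,b\rfloor$. $B$ is a Banach SSD space (Simons space) if it is an SSD space with a norm $\|\cdot\|$ making it a Banach space with norm-dual $B^*$, such that $\frac12\|\cdot\|^2+q\geq 0$ on $B$ and there exists a linear continuous map $\iota:B\to B^*$ with $\langle b,\iota(c)\rangle=\lfloor b,c\rfloor$ for all $b,c\in B$. A set $A\subseteq B$ is $q$-positive if $A\neq\emptyset$ and $q(b-c)\geq 0$ for all $b,c\in A$; it is maximally $q$-positive if it is $q$-positive and maximal with respect to inclusion among the $q$-positive subsets of $B$. $\mathbb{R}_+=[0,+\infty)$, $\overline{\mathbb{R}}=\mathbb{R}\cup\{\pm\infty\}$. The graph of $E:\mathbb{R}_+\rightrightarrows B$ is $G(E)=\{(\varepsilon,b)\in\mathbb{R}_+\times B: b\in E(\varepsilon)\}$; $E$ is closed if $G(E)$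 is closed (norm topology). A multifunction $E:\mathbb{R}_+\rightrightarrows B$ satisfies the transportation formula if for all $\varepsilon_1,\varepsilon_2\geq 0$, $b^1\in E(\varepsilon_1)$, $b^2\in E(\varepsilon_2)$ and all $\alpha_1,\alpha_2\geq 0$ with $\alpha_1+\alpha_2=1$ one has $\varepsilon:=\alpha_1\varepsilon_1+\alpha_2\varepsilon_2+\alpha_1\alpha_2 q(b^1-b^2)\geq 0$ and $\alpha_1b^1+\alpha_2b^2\in E(\varepsilon)$. $\mathbb{E}(A)$ is the family of multifunctions $E:\mathbb{R}_+\rightrightarrows B$ such that: (r1) $A\subseteq E(\varepsilon)$ for all $\varepsilon\geq 0$; (r2) $0\leq\varepsilon_1\leq\varepsilon_2$ implies $E(\varepsilon_1)\subseteq E(\varepsilon_2)$; (r3) $E$ satisfies the transportation formula. $\mathbb{E}_c(A)=\{E\in\mathbb{E}(A):E\text{ is closed}\}$. For $E:\mathbb{R}_+\rightrightarrows B$, define $\lambda_E:B\to\overline{\mathbb{R}}$, $\lambda_E(b)=\inf\{\varepsilon\geq 0:b\in E(\varepsilon)\}$ (with $\inf\emptyset=+\infty$), and $\Lambda_E:=\lambda_E+q$. For $h:B\to\overline{\mathbb{R}}$ put $\mathcal{P}(h)=\{b\in B:h(b)=q(b)\}$. $\mathcal{H}(A)$ is the family of convex lower semicontinuous functions $h:B\to\overline{\mathbb{R}}$ such that $h\geq q$ on $B$ and $A\subseteq\mathcal{P}(h)$. For $h\in\mathcal{H}(A)$, $A_h:\mathbb{R}_+\rightrightarrows B$ is defined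 by $A_h(\varepsilon)=\{b\in B:h(b)\leq\varepsilon+q(b)\}$ for all $\varepsilon\geq 0$. *)

(* Defs.v *)
From mathcomp Require Import all_boot all_order all_algebra.
From mathcomp Require Import all_classical all_reals all_analysis.

Set Implicit Arguments.
Unset Strict Implicit.
Unset Printing Implicit Defensive.

Import Order.TTheory GRing.Theory Num.Theory.
Import numFieldNormedType.Exports.

Local Open Scope classical_set_scope.
Local Open Scope ring_scope.

Section NormDual.
Context {R : realType} {B : normedModType R}.

Definition norm_dual : set (B -> R^o) :=
  [set f | linear f /\ continuous f].

(* Meaningful on norm_dual, where the supremum is over a bounded set. *)
Definition dual_norm (f : B -> R^o) : R :=
  sup [set `|f b| | b in [set b : B | `|b| <= 1]].

End NormDual.

Section SSD.
Context {R : realType} {B : completeNormedModType R}.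

(* {symmetric B} is the type of symmetric R-bilinear forms B -> B -> R. *)
Variable form : {symmetric B}.

Definition qform (b : B) : R := 2^-1 * form b b.

(* The continuity of iota is that of a map from B to its dual equipped with the
   dual norm. *)
Definition banach_SSD : Prop :=
  [/\ exists b : B, b != 0,
      forall b : B, 0 <= 2^-1 * `|b| ^+ 2 + qform b
    & exists iota : B -> (B -> R^o),
        [/\ forall c, norm_dual (iota c),
            linear iota,
            forall c, dual_norm (iota x - iota c) @[x --> c] --> (0 : R)
          & forall b c, iota c b = form b c]].

Definition q_positive (A : set B) : Prop :=
  A !=set0 /\ forall b c, A b -> A c -> 0 <= qform (b - c).

Definition maximally_q_positive (A : set B) : Prop :=
  q_positive A /\ forall A', q_positive A' -> A `<=` A' -> A' = A.

Definition multifun : Type := {nonneg R} -> set B.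

Implicit Types (A : set B) (E : multifun) (h : B -> \bar R).

Definition graph E : set (R * B) :=
  [set p | exists2 e : {nonneg R}, p.1 = e%:num & E e p.2].

(* [0, +oo[ being closed in R, closedness in R * B is the same as closedness
   in [0, +oo[ * B. *)
Definition closed_multifun E : Prop := closed (graph E).

(* The nonnegativity of the combined parameter is carried by the type of e. *)
Definition transportation_formula E : Prop :=
  forall (e1 e2 : {nonneg R}) (b1 b2 : B), E e1 b1 -> E e2 b2 ->
  forall a1 a2 : R, 0 <= a1 -> 0 <= a2 -> a1 + a2 = 1 ->
  exists2 e : {nonneg R},
    e%:num = a1 * e1%:num + a2 * e2%:num + a1 * a2 * qform (b1 - b2)
    & E e (a1 *: b1 + a2 *: b2).

Definition family_E A : set multifun :=
  [set E | [/\ forall e, A `<=` E e,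
               forall e1 e2 : {nonneg R}, e1%:num <= e2%:num -> E e1 `<=` E e2
             & transportation_formula E]].

Definition family_Ec A : set multifun :=
  [set E | family_E A E /\ closed_multifun E].

Definition lambda_of E : B -> \bar R :=
  fun b => ereal_inf [set (e%:num)%:E | e in [set e : {nonneg R} | E e b]].

Definition Lambda_of E : B -> \bar R := fun b => (lambda_of E b + (qform b)%:E)%E.

Definition contact_set h : set B := [set b | h b = (qform b)%:E].

(* The dual addition makes (+oo) + (-oo) equal to +oo, the usual convention for
   convex functions. *)
Definition convex_efun h : Prop :=
  forall (x y : B) (t : R), 0 < t -> t < 1 ->
  (h (t *: x + (1 - t) *: y)%R
    <= dual_adde (t%:E * h x) ((1 - t)%R%:E * h y))%E.

Definition family_H A : set (B -> \bar R) :=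
  [set h | [/\ convex_efun h,
               lower_semicontinuous h,
               forall b, ((qform b)%:E <= h b)%E
             & A `<=` contact_set h]].

Definition enlargement_of h : multifun :=
  fun e => [set b | (h b <= (e%:num)%:E + (qform b)%:E)%E].

End SSD.

(* Main.v *)
From HB Require Import structures.
Require Import Defs.
From mathcomp Require Import all_boot all_order all_algebra.
From mathcomp Require Import all_classical all_reals all_analysis.
From mathcomp Require Import ring lra.

Import Order.TTheory GRing.Theory Num.Theory.
Import numFieldNormedType.Exports.

Local Open Scope classical_set_scope.
Local Open Scope ring_scope.

(** Everything rests on one observation: a closed increasing multifunction [E]
    is the family of sublevel sets of [lambda_of E] ([lambda_of_le]), because
    closedness of the graph makes the infimum that defines [lambda_of E b]
    attained.  After adding [q], membership [E e b] reads
    [Lambda_of E b <= e + q b], which is what [enlargement_of] inverts; so the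
    two maps undo each other, and it remains to match the defining properties of
    the two families.

    - The transportation formula for [E] is convexity of [Lambda_of E].  The link
      is the identity
        [q (a1 b1 + a2 b2) = a1 q b1 + a2 q b2 - a1 a2 q (b1 - b2)]
      ([qform_convex_comb]): its last term is the correction in the formula.
      The nonnegativity of the new parameter is the inequality [q <= h].
    - Closedness of the graph of [E] is lower semicontinuity of [Lambda_of E].
      Both directions move the finite continuous function [q] across an
      inequality, hence use [lower_semicontinuousD] and the continuity of [q].
      The latter holds because a map [iota] that is continuous into the dual
      forces the bilinear form to be bounded ([form_bounded]).
    - [E] contains [A] at parameter [0] exactly when [lambda_of E] vanishes on
      [A], that is, when [A] is in the contact set of [Lambda_of E]. *)

(** * Continuity of the quadratic form *)

Section DualNorm.
Context {R : realType} {B : normedModType R}.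

(** A continuous linear functional is bounded on the unit ball, so the supremum
    in [dual_norm] is a true one and scaling [b] to norm one gives the bound. *)
Lemma ler_dual_norm (f : B -> R^o) (b : B) :
  norm_dual f -> `|f b| <= dual_norm f * `|b|.
Proof.
move=> [flin fcont].
pose g : {linear B -> R^o} := HB.pack f (GRing.isLinear.Build _ _ _ _ f flin).
have /linear_boundedP := @continuous_linear_bounded _ _ _ 0 g (fcont 0).
move=> [M [_ /(_ (M + 1))]]; rewrite ltrDl ltr01 => /(_ isT) gM.
have bnd : has_ubound [set `|f x| | x in [set x : B | `|x| <= 1]].
  exists `|M + 1| => _ [x /= x1 <-]; apply: le_trans (gM x) _.
  rewrite (le_trans (ler_norm _))// normrM normr_id.
  by rewrite ler_piMr.
have [->|b0] := eqVneq b 0.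
  by have := linear0 g; rewrite /= => ->; rewrite !normr0 mulr0.
have nb : 0 < `|b| by rewrite normr_gt0.
rewrite -ler_pdivrMr//; apply: ub_le_sup => //=.
exists (`|b|^-1 *: b).
  by rewrite /= normrZ normfV normr_id mulVf// gt_eqF.
have -> : f (`|b|^-1 *: b) = `|b|^-1 * f b by have := linearZ_LR g `|b|^-1 b.
by rewrite normrM normfV normr_id mulrC.
Qed.

End DualNorm.

Section QuadraticForm.
Context {R : realType} {B : completeNormedModType R}.
Variable form : {symmetric B}.

Lemma formC x y : form x y = form y x.
Proof. by rewrite hermC /= expr0 mul1r. Qed.

(** The identity that turns the transportation formula into convexity: along a
    segment, [q] falls short of affine interpolation by [a1 a2 q (x - y)]. *)
Lemma qform_convex_comb (a1 a2 : R) (x y : B) : a1 + a2 = 1 ->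
  qform form (a1 *: x + a2 *: y) =
  a1 * qform form x + a2 * qform form y - a1 * a2 * qform form (x - y).
Proof.
move=> a12; have -> : a2 = 1 - a1 by rewrite -a12 addrC addKr.
rewrite /qform !(linearDl form, linearDr form, linearNl form, linearNr form).
rewrite !(linearZl_LR form, linearZr_LR form) /= /GRing.scale /=.
rewrite (formC y x).
by field.
Qed.

(** Continuity of [iota] at [0] gives a radius [d] such that
    [dual_norm (iota c - iota 0) < 1] for [`|c| < d].  Rescaling an arbitrary [c]
    into that ball yields the constant [2 / d]. *)
Lemma form_bounded : banach_SSD form ->
  exists2 K : R, 0 <= K & forall b c, `|form b c| <= K * `|b| * `|c|.
Proof.
move=> [_ _ [iota [iotaD iotalin iotacont iotaE]]].
have dualE b c : `|form b c| <= dual_norm (iota c - iota 0) * `|b|.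
  (* [iota 0] is kept since the convergence of [iota] is about differences. *)
  have -> : form b c = (iota c - iota 0) b.
    by rewrite fctE opprfctE !iotaE linear0r subr0.
  apply: ler_dual_norm.
  suff -> : iota c - iota 0 = iota c by exact: iotaD.
  by apply/funext => x; rewrite fctE opprfctE !iotaE linear0r subr0.
have /cvgrPdist_lt /(_ 1 ltr01) := iotacont 0.
move=> /nbhs_ballP[d /= d0 dP].
exists (2 / d) => [|b c]; first by rewrite divr_ge0// ltW.
have [->|c0] := eqVneq c 0; first by rewrite linear0r !normr0 mulr0.
have nc : 0 < `|c| by rewrite normr_gt0.
(* Half the radius, so that [t *: c] lies strictly inside the ball. *)
pose t := d / 2 / `|c|.
have t0 : 0 < t by rewrite !divr_gt0.
have := dualE b (t *: c); rewrite linearZr /= normrM (gtr0_norm t0) => le1.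
have le2 : dual_norm (iota (t *: c) - iota 0) <= 1.
  have : ball 0 d (t *: c).
    rewrite -ball_normE /= sub0r normrN normrZ gtr0_norm// /t.
    by rewrite mulfVK ?gt_eqF// ltr_pdivrMr// ltr_pMr// ltr1n.
  move=> /dP /=; rewrite sub0r normrN => /ltW; exact: le_trans (ler_norm _).
have : t * `|form b c| <= `|b|.
  by rewrite (le_trans le1)// ler_piMl.
rewrite mulrC -ler_pdivlMr// => /le_trans; apply.
rewrite le_eqVlt; apply/orP; left; apply/eqP; rewrite /t.
by field; rewrite !gt_eqF.
Qed.

(** By symmetry [q x - q y = form (x - y) (x + y) / 2], which a bounded form
    makes small when [y] is near [x]. *)
Lemma qform_continuous : banach_SSD form -> continuous (qform form : B -> R).
Proof.
move=> /form_bounded[K K0 formK] x.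
have qB y : `|qform form x - qform form y| <= `|x - y| * (K * `|x + y|).
  have -> : qform form x - qform form y = 2^-1 * form (x - y) (x + y).
    rewrite /qform !(linearDl form, linearDr form, linearNl form, linearNr form).
    by rewrite /= (formC y x); field.
  rewrite normrM ger0_norm// mulrCA mulrA.
  rewrite (le_trans _ (formK _ _))// ler_piMl// invf_le1// ler1n//.
apply/cvgrPdist_lt => e e0.
have : (fun y => `|x - y| * (K * `|x + y|)) @ x --> `|x - x| * (K * `|x + x|).
  apply: cvgM; first by apply: cvg_norm; apply: cvgB => //; exact: cvg_cst.
  apply: cvgMl_tmp; apply: cvg_norm; apply: cvgD => //; exact: cvg_cst.
rewrite subrr normr0 mul0r => /cvgrPdist_lt /(_ _ e0).
apply: filterS => y; rewrite sub0r normrN => /(le_lt_trans _); apply.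
exact: le_trans (qB y) (ler_norm _).
Qed.

End QuadraticForm.

(** * Lower semicontinuous extended-real functions *)

Section LowerSemicontinuity.
Context {X : topologicalType} {R : realType}.

Lemma lower_semicontinuousD (f : X -> \bar R) (g : X -> R) :
  lower_semicontinuous f -> continuous g ->
  lower_semicontinuous (fun x => f x + (g x)%:E)%E.
Proof.
move=> flsc gcont x a afg.
(* A real level [s] strictly between [a - g x] and [f x] leaves room
   [s - (a - g x)] for the variation of [g]. *)
have [s as_ sf] : exists2 s, a - g x < s & (s%:E < f x)%E.
  move: afg; case: (f x) => [r| |] //=.
  - rewrite -EFinD lte_fin => ar; exists ((a - g x + r) / 2); rewrite ?lte_fin.
      by lra.
    by lra.
  - by move=> _; exists (a - g x + 1); rewrite ?ltry// ltrDl.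
have [V Vx Vf] := flsc x s sf.
have d0 : 0 < s - (a - g x) by rewrite subr_gt0.
have /cvgrPdist_lt /(_ _ d0) gnear := gcont x.
exists (V `&` [set y | `|g x - g y| < s - (a - g x)]); first exact: filterI.
move=> y [/Vf + /= gy]; have := le_lt_trans (ler_norm _) gy.
case: (f y) => [r| |] //=; rewrite -?EFinD ?lte_fin; last by rewrite addye ?ltry.
by move=> *; lra.
Qed.

Lemma lower_semicontinuous_comp (Y : topologicalType) (f : X -> \bar R)
    (p : Y -> X) : continuous p -> lower_semicontinuous f ->
  lower_semicontinuous (f \o p).
Proof.
move=> pcont /lower_semicontinuousP flsc; apply/lower_semicontinuousP => a.
by move/continuousP : pcont => /(_ _ (flsc a)).
Qed.

End LowerSemicontinuity.

(** * Enlargements as sublevel sets *)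

Section Correspondence.
Context {R : realType} {B : completeNormedModType R}.
Variables (form : {symmetric B}) (A : set B).
Implicit Types (E : @multifun R B) (h : B -> \bar R).

Lemma lambda_of_ge0 E b : (0 <= lambda_of E b)%E.
Proof. by apply: le_ereal_inf_tmp => _ [e _ <-]; rewrite lee_fin. Qed.

(** Parameters slightly above the infimum are admissible by monotonicity, and
    they converge to [e]; closedness of the graph then admits [e] itself. *)
Lemma lambda_of_le E (e : {nonneg R}) b : family_Ec form A E ->
  (lambda_of E b <= (e%:num)%:E)%E <-> E e b.
Proof.
move=> [[_ Emono _] Ecl]; split=> [le|Eeb]; last first.
  by apply: ereal_inf_lbound; exists e.
have scl : closed [set r : R | graph E (r, b)].
  apply: (@preimage_closed _ _ (fun r : R => (r, b)) (graph E)) => //.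
  by move=> r _; apply: (@cvg_pair _ _ _ _ (nbhs r) (nbhs b)) => //;
    exact: cvg_cst.
have [e' /= ee' Ee'] : [set r : R | graph E (r, b)] e%:num.
  apply: scl => V /nbhs_ballP[d /= d0 dV].
  have : (lambda_of E b < (e%:num + d / 2)%:E)%E.
    by apply: le_lt_trans le _; rewrite lte_fin ltrDl divr_gt0.
  move=> /ereal_inf_lt[_ [e1 /= Ee1 <-]]; rewrite lte_fin => e1lt.
  have p0 : 0 <= e%:num + d / 2 by rewrite addr_ge0// divr_ge0// ltW.
  exists (e%:num + d / 2); split.
    exists (NngNum p0) => //=; apply: Emono Ee1 => /=; exact: ltW.
  apply: dV; rewrite -ball_normE /= opprD addNKr normrN gtr0_norm ?divr_gt0//.
  by rewrite ltr_pdivrMr// ltr_pMr// ltr1n.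
by apply: Emono Ee'; rewrite ee'.
Qed.

Lemma enlargement_of_Lambda E : family_Ec form A E ->
  enlargement_of form (Lambda_of form E) = E.
Proof.
move=> EE; apply/funext => e; apply/seteqP; split=> b;
  by rewrite /enlargement_of /Lambda_of /= leeD2rE// => /lambda_of_le; exact.
Qed.

(** Where [h] is finite, [e] is admissible for [b] exactly when [h b - q b <= e];
    since [h b - q b] is nonnegative it is itself a parameter, hence the infimum.
    Where [h] is infinite no parameter is admissible. *)
Lemma Lambda_of_enlargement h : (forall b, ((qform form b)%:E <= h b)%E) ->
  Lambda_of form (enlargement_of form h) = h.
Proof.
move=> hq; apply/funext => b; rewrite /Lambda_of /lambda_of /enlargement_of /=.
have := hq b; case hb : (h b) => [r| |] //=.
- rewrite lee_fin => qr; have rq0 : 0 <= r - qform form b by rewrite subr_ge0.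
  suff -> : ereal_inf [set (e%:num)%:E | e in [set e : {nonneg R} |
      (r%:E <= (e%:num)%:E + (qform form b)%:E)%E]] = (r - qform form b)%:E.
    by rewrite -EFinD subrK.
  apply/le_anti/andP; split.
    apply: ereal_inf_lbound; exists (NngNum rq0) => //=.
    by rewrite -EFinD subrK.
  apply: le_ereal_inf_tmp => _ [e /= + <-].
  by rewrite -EFinD !lee_fin lerBlDr.
- move=> _; rewrite (_ : [set _ | _ in _] = set0) ?ereal_inf0 ?addye//.
  by rewrite -subset0 => _ [e /= + _]; rewrite -EFinD leye_eq.
Qed.

(** * From closed enlargements to convex functions *)

(** At points with finite values the infima are attained, so the transportation
    formula applies to them; its correction term cancels against that of
    [qform_convex_comb]. *)
Lemma Lambda_of_convex E : family_Ec form A E -> convex_efun (Lambda_of form E).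
Proof.
move=> EE x y t t0 t1; have [[_ _ Etr] _] := EE.
have s0 : 0 < 1 - t by rewrite subr_gt0.
have attained z : (Lambda_of form E z = +oo)%E \/
    exists2 e : {nonneg R}, E e z
      & Lambda_of form E z = (e%:num + qform form z)%:E.
  have := lambda_of_ge0 E z; rewrite /Lambda_of.
  case lz : (lambda_of E z) => [r| |] //=; last by left.
  rewrite lee_fin => r0; right; exists (NngNum r0) => //=.
  by apply/lambda_of_le => //=; rewrite lz.
have [->|[e1 E1 ->]] := attained x.
  rewrite mulry gtr0_sg// mul1e /=.
  by case: (_ * _)%E => [?| |]; exact: leey.
have [->|[e2 E2 ->]] := attained y.
  by rewrite mulry gtr0_sg// mul1e /= leey.
have [e eE Ee] := Etr _ _ _ _ E1 E2 t (1 - t) (ltW t0) (ltW s0) (subrKC _ _).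
rewrite /Lambda_of -!EFinM /=.
have /lambda_of_le := Ee; move=> /(_ EE) le.
apply: le_trans (leeD2r _ le) _.
by rewrite -EFinD lee_fin eE qform_convex_comb ?subrKC//; lra.
Qed.

(** The sublevel set at [s >= 0] is the slice of the closed graph at [s]; for
    [s < 0] it is empty. *)
Lemma lambda_of_lsc E : family_Ec form A E -> lower_semicontinuous (lambda_of E).
Proof.
move=> EE; apply/lower_semicontinuousP => s.
have [s0|s0] := ltP s 0.
  rewrite (_ : [set x | _] = setT); first exact: openT.
  apply/seteqP; split=> // x _ /=.
  by apply: lt_le_trans (lambda_of_ge0 E x); rewrite lte_fin.
have -> : [set x | (s%:E < lambda_of E x)%E] = ~` [set x | graph E (s, x)].
  apply/seteqP; split=> x /=.
    rewrite ltNge => /negP le [e /= se Ee]; apply: le.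
    by rewrite se; apply/lambda_of_le.
  move=> nE; rewrite ltNge; apply/negP => le; apply: nE.
  exists (NngNum s0) => //=; exact/lambda_of_le.
rewrite openC; have [_ Ecl] := EE.
apply: (@preimage_closed _ _ (fun x : B => (s, x)) (graph E)) => //.
by move=> x _; apply: (@cvg_pair _ _ _ _ (nbhs s) (nbhs x)) => //;
  exact: cvg_cst.
Qed.

Lemma Lambda_of_family_H E : banach_SSD form ->
  family_Ec form A E -> family_H form A (Lambda_of form E).
Proof.
move=> SSD EE; split.
- exact: Lambda_of_convex.
- apply: lower_semicontinuousD; first exact: lambda_of_lsc.
  exact: qform_continuous.
- by move=> b; rewrite /Lambda_of leeDr// lambda_of_ge0.
- move=> b Ab; rewrite /contact_set /Lambda_of /=.
  suff -> : lambda_of E b = 0%E by rewrite add0e.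
  apply/le_anti; rewrite lambda_of_ge0 andbT.
  have [[AE _ _] _] := EE.
  have : (lambda_of E b <= (0%:nng%:num : R)%:E)%E.
    by apply/lambda_of_le => //; exact: AE.
  by [].
Qed.

(** * From convex functions to closed enlargements *)

(** Convexity bounds [h] at the combination by [e + q], where [e] is the combined
    parameter; together with [q <= h] this also gives [0 <= e]. *)
Lemma enlargement_of_transportation h : convex_efun h ->
  (forall b, ((qform form b)%:E <= h b)%E) ->
  transportation_formula form (enlargement_of form h).
Proof.
move=> hconv hq e1 e2 b1 b2 h1 h2 a1 a2 a10 a20 a12.
have le : (h (a1 *: b1 + a2 *: b2)%R <= (a1 * e1%:num + a2 * e2%:num
    + a1 * a2 * qform form (b1 - b2) + qform form (a1 *: b1 + a2 *: b2))%R%:E)%E.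
  have a2E : a2 = 1 - a1 by rewrite -a12 addrC addKr.
  rewrite (qform_convex_comb form _ _ _ _ a12).
  (* Convexity speaks only of weights in the open unit interval. *)
  have [a1z|a1N0] := eqVneq a1 0.
    move: h2; rewrite a2E a1z subr0 scale0r scale1r !add0r /enlargement_of /=.
    by rewrite -EFinD !(mul0r, mul1r, add0r, addr0, subr0).
  have [a2z|a2N0] := eqVneq a2 0.
    have a11 : a1 = 1 by rewrite -a12 a2z addr0.
    move: h1; rewrite a2z a11 scale0r scale1r addr0 /enlargement_of /=.
    by rewrite -EFinD !(mul0r, mulr0, mul1r, addr0, subr0).
  have a1p : 0 < a1 by rewrite lt_neqAle eq_sym a1N0.
  have a2p : 0 < a2 by rewrite lt_neqAle eq_sym a2N0.
  have a1lt : a1 < 1 by rewrite -subr_gt0 -a2E.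
  move: h1 h2 (hq b1) (hq b2) (hconv b1 b2 a1 a1p a1lt).
  rewrite /enlargement_of /= -!EFinD -a2E.
  case: (h b1) => [r1| |] //; case: (h b2) => [r2| |] //.
  rewrite -!EFinM /dual_adde /= !lee_fin => h1 h2 _ _ /le_trans; apply.
  rewrite lee_fin.
  by have := ler_wpM2l a10 h1; have := ler_wpM2l a20 h2; lra.
have e0 : 0 <= a1 * e1%:num + a2 * e2%:num + a1 * a2 * qform form (b1 - b2).
  by have := le_trans (hq _) le; rewrite lee_fin lerDr.
by exists (NngNum e0) => //=; rewrite /enlargement_of /= -EFinD.
Qed.

(** On pairs with nonnegative first component, the graph is the sublevel set at
    [0] of [(r, b) |-> h b - (r + q b)], a lower semicontinuous function on the
    product. *)
Lemma enlargement_of_closed h : banach_SSD form -> lower_semicontinuous h ->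
  closed_multifun (enlargement_of form h).
Proof.
move=> SSD hlsc; rewrite /closed_multifun.
have -> : graph (enlargement_of form h) = (@fst R B) @^-1` [set r | 0 <= r] `&`
    ~` [set p : R * B | (0%:E < h p.2 + (- (p.1 + qform form p.2))%:E)%E].
  have iff (r : R) b : (h b <= r%:E + (qform form b)%:E)%E <->
      ~ (0%:E < h b + (- (r + qform form b))%:E)%E.
    rewrite -EFinD; case: (h b) => [s| |] /=.
    - rewrite -EFinD lte_fin lee_fin subr_gt0 ltNge; split => [->//|].
      by move/negP; rewrite negbK.
    - by rewrite addye// ltry leye_eq; split.
    - by rewrite addNye ltNge !leNye; split.
  apply/seteqP; split=> [[r b] [e /= -> /iff he]|[r b] [/= r0 /iff hr]] //.
  by exists (NngNum r0).
apply: closedI.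
  apply: preimage_closed; last exact: closed_ge.
  by move=> p _; exact: cvg_fst.
rewrite closedC; move: (0 : R); apply/lower_semicontinuousP.
apply: lower_semicontinuousD.
  by apply: lower_semicontinuous_comp hlsc => p; exact: cvg_snd.
move=> p; apply: cvgN; apply: cvgD; first exact: cvg_fst.
by apply: continuous_comp; [exact: cvg_snd|exact: qform_continuous].
Qed.

Lemma enlargement_of_family_Ec h : banach_SSD form ->
  family_H form A h -> family_Ec form A (enlargement_of form h).
Proof.
move=> SSD [hconv hlsc hq hA]; split; last exact: enlargement_of_closed.
split; last exact: enlargement_of_transportation.
- move=> e b /hA hb; rewrite /enlargement_of /=.
  by rewrite (hb : h b = _) leeDr// lee_fin.
- move=> e1 e2 e12 b /le_trans; apply; exact: leeD2r.
Qed.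

End Correspondence.

Theorem theorem13 (R : realType) (B : completeNormedModType R)
    (form : {symmetric B}) (A : set B) :
  banach_SSD form -> maximally_q_positive form A ->
  [/\ set_bij (family_Ec form A) (family_H form A) (Lambda_of form),
      set_fun (family_H form A) (family_Ec form A) (enlargement_of form),
      forall E, family_Ec form A E -> enlargement_of form (Lambda_of form E) = E
    & forall h, family_H form A h -> Lambda_of form (enlargement_of form h) = h].
Proof.
move=> SSD _.
have EL := @enlargement_of_Lambda R B form A.
have LE h : family_H form A h -> Lambda_of form (enlargement_of form h) = h.
  by move=> [_ _ hq _]; exact: Lambda_of_enlargement.
have funEc h := @enlargement_of_family_Ec R B form A h SSD.
split=> //; split.
- by move=> E; exact: Lambda_of_family_H.
- by move=> E F /set_mem EE /set_mem EF eqL; rewrite -(EL E)// eqL EL.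
- by move=> h Hh; exists (enlargement_of form h); [exact: funEc|exact: LE].
Qed.
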